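(* Let $k \ge 2$ and let $(X,\mathcal{L})$ be a finite projective plane of order $k$. Let $G$ be its incidence graph, i.e. the bipartite graph with vertex set $X \cup \mathcal{L}$ in which a point $x \in X$ is adjacent to a line $\ell \in \mathcal{L}$ if and only if $x \in \ell$. Then $\mathrm{fun}(G) = k+1$. Moreover, for every proper induced subgraph $G'$ of $G$ we have $\mathrm{fun}(G') \le k$.
   Context: A finite projective plane is a pair $(X,\mathcal{L})$ with $X$ a finite set and $\mathcal{L}\subseteq 2^X$ such that: any two distinct points lie in exactly one common line; any two distinct lines meet in exactly one point; and there is a set $Y\subseteq X$ of four points with $|L\cap Y|\le 2$ for every $L\in\mathcal{L}$. It has order $k$ if every line contains exactly $k+1$ points (then every point lies on $k+1$ lines and there are $k^2+k+1$ points and $k^2+k+1$ lines). Functionality: let $G=(V,E)$ be a finite simple graph with adjacency matrix $A$. A vertex $v$ is a function of distinct vertices $u_1,\dots,u_k \in V\setminus\{v\}$ if there is a Boolean function $f:\{0,1\}^k\to\{0,1\}$ such that for every vertex $w \in V\setminus\{v,u_1,\dots,u_k\}$ we have $A[v,w] = f(A[w,u_1],\dots,A[w,u_k])$. The functionality $\mathrm{fun}_G(v)$ is the minimum $k$ such that $v$ is a function of some $k$ vertices of $G$. The functionality of $G$ is $\mathrm{fun}(G)=\max_{H}\min_{v\in V(H)} \mathrm{fun}_H(v)$, the maximum taken over all (nonempty) induced subgraphs $H$ of $G$. *)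

(* Defs.v *)
From mathcomp Require Import all_boot.

Set Implicit Arguments.
Unset Strict Implicit.
Unset Printing Implicit Defensive.

Record sgraph := SGraph {
  vertex :> finType;
  adj : rel vertex;
  adj_sym : symmetric adj;
  adj_irrefl : irreflexive adj }.

Section Induced.
Variables (G : sgraph) (S : {set G}).

Definition induced_adj : rel {x : G | x \in S} :=
  fun x y => adj (val x) (val y).

Lemma induced_sym : symmetric induced_adj.
Proof. by move=> x y; apply: adj_sym. Qed.

Lemma induced_irrefl : irreflexive induced_adj.
Proof. by move=> x; apply: adj_irrefl. Qed.

Definition induced : sgraph := SGraph induced_sym induced_irrefl.
End Induced.

Section Functionality.
Variable G : sgraph.

Definition is_function_of (v : G) (k : nat) (u : k.-tuple G) : bool :=
  [exists f : {ffun k.-tuple bool -> bool},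
    [forall w, (w != v) && (w \notin u) ==>
                 (adj v w == f [tuple of [seq adj w x | x <- u]])]].

Definition function_of_some (v : G) (k : nat) : bool :=
  [exists u : k.-tuple G, [&& uniq u, v \notin u & is_function_of v u]].

Lemma function_of_others (v : G) : function_of_some v #|predC1 v|.
Proof.
apply/existsP; exists (enum_tuple (predC1 v)).
rewrite enum_uniq mem_enum inE eqxx /=.
apply/existsP; exists [ffun=> false]; apply/forallP => w; apply/implyP.
by rewrite mem_enum inE => /andP[->].
Qed.

Lemma function_of_some_ex (v : G) : exists k, function_of_some v k.
Proof. by exists #|predC1 v|; apply: function_of_others. Qed.

Definition vfun (v : G) : nat := ex_minn (function_of_some_ex v).

Lemma vfun_lt_card (v : G) : vfun v < #|G|.
Proof.
rewrite /vfun; case: ex_minnP => m _ /(_ _ (function_of_others v)).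
by rewrite (cardD1 v G) inE add1n ltnS => /leq_trans; apply; apply: subset_leq_card;
  apply/subsetP => x; rewrite !inE andbT.
Qed.

(* By vfun_lt_card, the default value #|G| is never smaller than a vfun v, so
   this is the true minimum as soon as G has a vertex. *)
Definition min_vfun : nat := \big[minn/#|G|]_(v : G) vfun v.
End Functionality.

(* The functionality of the graph without vertices is 0. *)
Definition functionality (G : sgraph) : nat :=
  \max_(H : {set G} | H != set0) min_vfun (induced H).

Definition projective_plane (X : finType) (L : {set {set X}}) : Prop :=
  [/\ forall x y : X, x != y ->
        #|[set l in L | (x \in l) && (y \in l)]| = 1,
      forall l m : {set X}, l \in L -> m \in L -> l != m -> #|l :&: m| = 1
    & exists2 Y : {set X}, #|Y| = 4 & forall l, l \in L -> #|l :&: Y| <= 2].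

Definition has_order (X : finType) (L : {set {set X}}) (k : nat) : Prop :=
  forall l : {set X}, l \in L -> #|l| = k.+1.

Section Incidence.
Variables (X : finType) (L : {set {set X}}).

Definition incidence_adj : rel (X + {l : {set X} | l \in L}) := fun a b =>
  match a, b with
  | inl x, inr l => x \in val l
  | inr l, inl x => x \in val l
  | _, _ => false
  end.

Lemma incidence_sym : symmetric incidence_adj.
Proof. by move=> [x|l] [y|m]. Qed.

Lemma incidence_irrefl : irreflexive incidence_adj.
Proof. by move=> [x|l]. Qed.

Definition incidence_graph : sgraph := SGraph incidence_sym incidence_irrefl.
End Incidence.

(* Main.v *)
Require Import Defs.
From mathcomp Require Import all_boot zify.

(** The incidence graph is (k+1)-regular, bipartite, and any two vertices of the
    same side have exactly one common neighbour; only these (self-dual)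
    properties matter.  A vertex is a function of its neighbours, since it is
    non-adjacent to everything else, so functionality is at most minimum degree.
    The graph being connected, each proper induced subgraph has a vertex of degree
    at most k.  Conversely, if U has at most k vertices and v is not in U, then
    counting yields both a neighbour and a non-neighbour of v, outside U, that
    are adjacent to no vertex of U; so v is not a function of U. *)

Set Implicit Arguments.
Unset Strict Implicit.
Unset Printing Implicit Defensive.

(** * Cardinality tools and the degree bound on functionality *)

Definition nbh (G : sgraph) (v : G) : {set G} := [set w | adj v w].

Lemma card_bigcup_leq (T I : finType) (U : {set I}) (F : I -> {set T}) c :
  (forall i, i \in U -> #|F i| <= c) -> #|\bigcup_(i in U) F i| <= #|U| * c.
Proof.
move=> hF; rewrite -sum_nat_const.
apply: (big_ind2 (fun (B : {set T}) n => #|B| <= n)) => //.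
- by rewrite cards0.
- move=> B1 n1 B2 n2 h1 h2; rewrite cardsU.
  by apply: leq_trans (leq_subr _ _) _; apply: leq_add.
Qed.

(** Vertices that are lines live in a subtype, whereas the axioms of the plane count lines in [L];
    this passes between the two counts. *)
Lemma card_sub_set (T : finType) (L : {set T}) (P : pred T) :
  #|[set l : {l | l \in L} | P (val l)]| = #|[set l in L | P l]|.
Proof.
rewrite -(card_imset _ val_inj); congr #|pred_of_set _|.
apply/setP => l; rewrite inE; apply/imsetP/andP => [[m]|[lL Pl]].
  by rewrite inE => Pm ->; split=> //; apply: valP.
by exists (exist _ l lL); rewrite ?inE.
Qed.

Lemma bigminn_leq (I : eqType) (s : seq I) (F : I -> nat) n i :
  i \in s -> \big[minn/n]_(j <- s) F j <= F i.
Proof.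
elim: s => //= j s IHs; rewrite big_cons inE => /orP[/eqP->|/IHs].
  exact: geq_minl.
by apply: leq_trans; apply: geq_minr.
Qed.

Lemma min_vfun_leq (G : sgraph) (v : G) : min_vfun G <= vfun v.
Proof. by apply: bigminn_leq; apply: mem_index_enum. Qed.

Lemma vfun_leq_degree (G : sgraph) (v : G) : vfun v <= #|nbh v|.
Proof.
rewrite /vfun; case: ex_minnP => m _ min_m; apply: min_m.
apply/existsP; exists (enum_tuple (mem (nbh v))).
rewrite enum_uniq mem_enum inE adj_irrefl /=.
apply/existsP; exists [ffun=> false]; apply/forallP => w; apply/implyP.
by rewrite mem_enum inE ffunE => /andP[_ /negbTE->].
Qed.

(** * Degrees under embeddings *)

Section Embedding.
Variables (H G : sgraph) (f : H -> G).
Hypotheses (f_inj : injective f) (f_adj : forall x y, adj (f x) (f y) = adj x y).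

Lemma degree_embed (v : H) : #|nbh v| <= #|nbh (f v)|.
Proof.
rewrite -(card_imset _ f_inj); apply/subset_leq_card/subsetP => _ /imsetP[w vw ->].
by move: vw; rewrite !inE f_adj.
Qed.

(** The neighbour [y] is lost in [H], so the degree drops by at least one. *)
Lemma degree_embed_lt (v : H) (y : G) :
  adj (f v) y -> (forall w, f w != y) -> #|nbh v| < #|nbh (f v)|.
Proof.
move=> vy y_out; rewrite -(card_imset _ f_inj); apply: proper_card.
apply/properP; split.
  by apply/subsetP => _ /imsetP[w vw ->]; move: vw; rewrite !inE f_adj.
exists y; first by rewrite inE.
by apply/imsetP => -[w _ yE]; move: (y_out w); rewrite yE eqxx.
Qed.

End Embedding.

(** * Bipartite regular graphs with unique common neighbours *)

Definition plane_graph (k : nat) (G : sgraph) (side : G -> bool) : Prop :=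
  [/\ forall x y, adj x y -> side x != side y,
      forall x y, x != y -> side x = side y -> #|nbh x :&: nbh y| = 1
    & forall x : G, #|nbh x| = k.+1].

(** [functionality] ranges over induced subgraphs, so [G] itself enters only as the isomorphic copy
    [induced [set: G]], to which the properties must be carried. *)
Lemma plane_graph_bij k (H G : sgraph) (f : H -> G) (side : G -> bool) :
  bijective f -> (forall x y, adj (f x) (f y) = adj x y) ->
  plane_graph k side -> plane_graph k (side \o f).
Proof.
move=> f_bij f_adj [sideN common degree].
have nbhE x : nbh x = f @^-1: nbh (f x).
  by apply/setP => y; rewrite !inE f_adj.
split=> [x y xy|x y xy sxy|x].
- by apply: sideN; rewrite f_adj.
- rewrite !nbhE -preimsetI on_card_preimset; last exact: onW_bij.
  by apply: common => //; rewrite (inj_eq (bij_inj f_bij)).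
- by rewrite nbhE on_card_preimset //; apply: onW_bij.
Qed.

Section PlaneGraph.
Variables (k : nat) (G : sgraph) (side : G -> bool).
Hypothesis planeG : plane_graph k side.

Let sideN x y : adj x y -> side x != side y.
Proof. by case: planeG => h _ _; apply: h. Qed.
Let common x y : x != y -> side x = side y -> #|nbh x :&: nbh y| = 1.
Proof. by case: planeG => _ h _; apply: h. Qed.
Let degree (x : G) : #|nbh x| = k.+1.
Proof. by case: planeG => _ _ h; apply: h. Qed.

Lemma exists_nbr (v : G) : exists n, adj v n.
Proof.
have /card_gt0P[n] : 0 < #|nbh v| by rewrite degree.
by rewrite inE; exists n.
Qed.

Lemma common_nbr (x y : G) : side x = side y -> exists2 n, adj x n & adj n y.
Proof.
move=> sxy; have [->|xy] := eqVneq x y.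
  by have [n yn] := exists_nbr y; exists n; rewrite // adj_sym.
have /card_gt0P[n] : 0 < #|nbh x :&: nbh y| by rewrite common.
by rewrite !inE => /andP[xn yn]; exists n; rewrite // adj_sym.
Qed.

(* Each w != v on the side of v is reached from v by exactly one path of
   length 2, and there are (k+1)k such paths. *)
Lemma card_side v : #|[set w | side w == side v]| = (k.+1 * k).+1.
Proof.
rewrite (cardsD1 v) inE eqxx add1n; congr S.
set S := _ :\ v.
have -> : #|S| = \sum_(w in S) \sum_(n in nbh v) adj n w.
  rewrite -sum1_card; apply: eq_bigr => w; rewrite !inE => /andP[wv /eqP swv].
  rewrite -(common (negbT (etrans (eq_sym v w) (negbTE wv))) (esym swv)).
  rewrite -sum1_card big_mkcond [RHS]big_mkcond /=; apply: eq_bigr => n _.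
  by rewrite !inE (adj_sym w n); case: (adj v n); case: (adj n w).
(* Each neighbour [n] of [v] contributes its [k] neighbours other than [v], all on the side of
   [v]. *)
rewrite exchange_big /= -(degree v) -sum_nat_const; apply: eq_bigr => n.
rewrite inE => vn; have := degree n; rewrite (cardsD1 v) inE adj_sym vn add1n.
case=> <-; rewrite -sum1_card big_mkcond [RHS]big_mkcond /=.
apply: eq_bigr => w _; rewrite !inE; case: eqVneq => //= _.
case nw: (adj n w); last by case: ifP.
have := sideN vn; have := sideN nw.
by case: (side v); case: (side n); case: (side w).
Qed.

(** Vertices of one side are joined through a common neighbour, and a single edge reaches the other
    side. *)
Lemma plane_graph_connected (A : {set G}) (x : G) :
  x \in A -> (forall y z : G, y \in A -> adj y z -> z \in A) -> A = setT.
Proof.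
move=> xA closedA.
have sideA y z : y \in A -> side y = side z -> z \in A.
  move=> yA /common_nbr[n yn nz].
  by apply: (closedA n) => //; apply: (closedA y).
apply/setP => z; rewrite inE.
have [/(sideA _ _ xA)//|sxz] := eqVneq (side x) (side z).
have [n xn] := exists_nbr x; apply: (sideA n); first exact: (closedA x).
have := sideN xn; move: sxz.
by case: (side x); case: (side n); case: (side z).
Qed.

(** * Vertices avoiding a small set *)

Section Avoiding.
Variables (v : G) (U : {set G}).
Hypotheses (vU : v \notin U) (cardU : #|U| <= k).

(** Each [x] in [U] excludes at most one of the [k.+1] neighbours of [v]: their common neighbour if
    [x] is on the side of [v], and otherwise only [x] itself. *)
Lemma avoiding_nbr :
  exists w : G, [/\ adj v w, w \notin U & forall x, x \in U -> ~~ adj w x].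
Proof.
pose F x := [set w in nbh v | (w == x) || adj w x].
have F_le1 x : x \in U -> #|F x| <= 1.
  move=> xU; have vx : v != x by apply: contraNneq vU => ->.
  have [svx|svx] := eqVneq (side v) (side x).
    rewrite -(common vx svx); apply/subset_leq_card/subsetP => w.
    rewrite !inE => /andP[vw /orP[/eqP wx|]]; last by rewrite vw adj_sym.
    by have := sideN vw; rewrite wx svx eqxx.
  rewrite -(cards1 x); apply/subset_leq_card/subsetP => w.
  rewrite !inE => /andP[vw /orP[//|wx]].
  have := sideN vw; have := sideN wx; move: svx.
  by case: (side v); case: (side x); case: (side w).
have lt_bad : #|\bigcup_(x in U) F x| < #|nbh v|.
  by rewrite degree ltnS (leq_trans (card_bigcup_leq F_le1)) // muln1.
have /subsetPn[w] : ~~ (nbh v \subset \bigcup_(x in U) F x).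
  by apply: contraL lt_bad => /subset_leq_card; rewrite leqNgt.
rewrite inE => vw wF; exists w; split=> [//||x xU].
  by apply: contra wF => wU; apply/bigcupP; exists w; rewrite // !inE vw eqxx.
by apply: contra wF => wx; apply/bigcupP; exists x; rewrite // !inE vw wx orbT.
Qed.

Lemma avoiding_non_nbr : 2 <= k ->
  exists w : G, [/\ ~~ adj v w, w != v, w \notin U
              & forall x, x \in U -> ~~ adj w x].
Proof.
move=> hk.
have same_nadj (x y : G) : side x = side y -> ~~ adj x y.
  by move=> sxy; apply/negP => /sideN; rewrite sxy eqxx.
have [/existsP[a /andP[aU /eqP sa]]|/existsPn noneU] :=
    boolP [exists a, (a \in U) && (side a == side v)].
  (* Look for [w] on the side of [v]. There [a] excludes only itself, since its neighbours are on
     the other side. So at most [2 + (k - 1) * (k + 2) = k^2 + k] vertices are excluded, one fewer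
     than the side has. *)
  pose B := v |: (a |: \bigcup_(x in U :\ a) (x |: nbh x)).
  have cardB : #|B| < #|[set w | side w == side v]|.
    have cardUa : #|U :\ a| < k by move: cardU; rewrite (cardsD1 a) aU.
    have cardF : #|\bigcup_(x in U :\ a) (x |: nbh x)| <= #|U :\ a| * k.+2.
      by apply: card_bigcup_leq => x _; rewrite cardsU1 degree; case: (_ \in _).
    rewrite card_side /B !cardsU1.
    case: (v \notin _); case: (a \notin _); nia.
  have /subsetPn[w] : ~~ ([set w | side w == side v] \subset B).
    by apply: contraL cardB => /subset_leq_card; rewrite leqNgt.
  rewrite !inE !negb_or => /eqP sw /and3P[wv wa wB].
  exists w; split=> // [||x xU].
  - exact: same_nadj.
  - apply: contra wB => wU; apply/bigcupP; exists w; first by rewrite !inE wa.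
    by rewrite !inE eqxx.
  - have [->|xa] := eqVneq x a; first by apply: same_nadj; rewrite sw.
    apply: contra wB => wx; apply/bigcupP; exists x; first by rewrite !inE xa.
    by rewrite !inE adj_sym wx orbT.
(* Now [U] lies on the side opposite to [v], and any [w] there outside [U] and [nbh v] will do. At
   most [2 * k + 1] vertices are excluded, fewer than [k^2 + k + 1] because [2 <= k]. *)
have [n vn] := exists_nbr v.
have cardB : #|nbh v :|: U| < #|[set w | side w == side n]|.
  by rewrite card_side cardsU degree; nia.
have /subsetPn[w] : ~~ ([set w | side w == side n] \subset nbh v :|: U).
  by apply: contraL cardB => /subset_leq_card; rewrite leqNgt.
rewrite !inE negb_or => /eqP sw /andP[vw wU].
exists w; split=> // [|x xU].
  by apply/eqP => wv; have := sideN vn; rewrite -sw wv eqxx.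
apply: same_nadj; rewrite sw; have := sideN vn; have := noneU x.
by rewrite xU /=; case: (side v); case: (side x); case: (side n).
Qed.

End Avoiding.

Lemma plane_graph_vfun_gt (v : G) : 2 <= k -> k < vfun v.
Proof.
move=> hk; rewrite /vfun; case: ex_minnP => m /existsP[u /and3P[_ vu]].
case/existsP=> f /forallP fP _; rewrite ltnNge; apply/negP => mk.
have vU : v \notin [set x in u] by rewrite inE.
have cardU : #|[set x in u]| <= k.
  by rewrite cardsE (leq_trans (card_size u)) // size_tuple.
have [w [vw wU w0]] := avoiding_nbr vU cardU.
have [z [vz zv zU z0]] := avoiding_non_nbr vU cardU hk.
have wv : w != v by apply: contraTneq vw => ->; rewrite adj_irrefl.
move: wU zU (fP w) (fP z); rewrite !inE => wu zu.
rewrite wv zv wu zu vw (negbTE vz) /= => /eqP fw /eqP fz.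
(* Both [w] and [z] present the all-false tuple to [f], yet [f] must return different values. *)
suff: true = false by [].
apply: etrans fw (etrans _ (esym fz)); congr (f _).
apply: val_inj => /=; apply/eq_in_map => x xu.
by rewrite (negbTE (w0 x _)) ?(negbTE (z0 x _)) ?inE.
Qed.

End PlaneGraph.

(** * Projective planes and their incidence graphs *)

Section ProjectivePlane.
Variables (X : finType) (L : {set {set X}}) (k : nat).
Hypotheses (planeL : projective_plane L) (ordL : has_order L k).

Lemma line_uniq (l m : {set X}) x y : l \in L -> m \in L -> x != y ->
  x \in l -> y \in l -> x \in m -> y \in m -> l = m.
Proof.
case: planeL => joinL _ _ lL mL /joinL/eqP/cards1P[n nE] xl yl xm ym.
have : l \in [set n] by rewrite -nE !inE lL xl yl.
have : m \in [set n] by rewrite -nE !inE mL xm ym.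
by rewrite !inE => /eqP-> /eqP->.
Qed.

Lemma line_through x y : x != y -> exists l, [/\ l \in L, x \in l & y \in l].
Proof.
case: planeL => joinL _ _ /joinL xy.
have /card_gt0P[l] : 0 < #|[set l in L | (x \in l) && (y \in l)]| by rewrite xy.
by rewrite !inE => /and3P[]; exists l.
Qed.

(** If all lines passed through [x], take three points [a], [b], [c] of [Y] other than [x]. The
    lines [ab] and [ac] share [a] and [x], so they coincide and hold three points of [Y]. *)
Lemma line_avoiding x : exists2 l, l \in L & x \notin l.
Proof.
case: planeL => _ _ [Y cardY arcY].
apply/exists_inP; apply: contraT; rewrite negb_exists_in.
move=> /forall_inP/= all_x.
have xl l : l \in L -> x \in l by move=> /all_x; rewrite negbK.
have card_Yx : 2 < #|Y :\ x|.
  by move: cardY; rewrite (cardsD1 x); case: (x \in Y); lia.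
have [a [b [c [[aY bY cY] [ab bc ca]]]]] := card_gt2P card_Yx.
have ac : a != c by rewrite eq_sym.
have [l [lL al bl]] := line_through ab.
have [m [mL am cm]] := line_through ac.
have ax : a != x by move: aY; rewrite !inE => /andP[].
have lm : l = m by apply: line_uniq ax _ _ _ _ => //; apply: xl.
have : 2 < #|l :&: Y|.
  apply/card_gt2P; exists a, b, c; split=> //.
  move: aY bY cY; rewrite !inE => /andP[_ ->] /andP[_ ->] /andP[_ ->].
  by rewrite al bl lm cm.
by rewrite ltnNge arcY.
Qed.

(* Double counting of the pairs (y, m) where y lies on both m and a fixed line l
   avoiding x, and m passes through x. *)
Lemma card_lines_through x : #|[set l in L | x \in l]| = k.+1.
Proof.
case: planeL => joinL meetL _.
have [l lL xl] := line_avoiding x; rewrite -(ordL lL).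
have -> : #|[set l in L | x \in l]| =
    \sum_(m in [set l in L | x \in l]) \sum_(y in l) (y \in m).
  rewrite -sum1_card; apply: eq_bigr => m; rewrite inE => /andP[mL xm].
  have lm : l != m by apply: contraNneq xl => ->.
  rewrite -(meetL l m) // -sum1_card big_mkcond [RHS]big_mkcond /=.
  by apply: eq_bigr => y _; rewrite inE; case: (y \in l); case: (y \in m).
rewrite exchange_big /= -sum1_card; apply: eq_bigr => y yl.
have xy : x != y by apply: contraNneq xl => ->.
rewrite -(joinL x y xy) -sum1_card big_mkcond [RHS]big_mkcond /=.
apply: eq_bigr => m _; rewrite !inE.
by case: (m \in L); case: (x \in m); case: (y \in m).
Qed.

(** Common neighbours are the joining line of two points or the meeting point of two lines. *)
Lemma incidence_plane_graph :
  @plane_graph k (incidence_graph L) (fun a => if a is inl _ then true else false).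
Proof.
case: planeL => joinL meetL _.
pose pt (x : X) : incidence_graph L := inl x.
pose ln (l : {l | l \in L}) : incidence_graph L := inr l.
have pt_inj : injective pt by move=> ? ? [].
have ln_inj : injective ln by move=> ? ? [].
have nbh_pt x : nbh (pt x) = ln @: [set l : {l | l \in L} | x \in val l].
  apply/setP => -[y|l]; rewrite inE /=.
    by apply/esym/negbTE/imsetP => -[].
  by rewrite (mem_imset _ _ ln_inj) inE.
have nbh_ln l : nbh (ln l) = pt @: val l.
  apply/setP => -[y|m]; rewrite inE /=; first by rewrite (mem_imset _ _ pt_inj).
  by apply/esym/negbTE/imsetP => -[].
split.
- by case=> [x|l] [y|m].
- case=> [x|l] [y|m] // xy _.
    rewrite !nbh_pt -imsetI; last by move=> ? ? _ _; apply: ln_inj.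
    rewrite (card_imset _ ln_inj) -(joinL x y xy) -card_sub_set.
    by congr #|pred_of_set _|; apply/setP => l; rewrite !inE.
  rewrite !nbh_ln -imsetI; last by move=> ? ? _ _; apply: pt_inj.
  by rewrite (card_imset _ pt_inj); apply: meetL => //; apply: valP.
- case=> [x|l].
    rewrite nbh_pt (card_imset _ ln_inj) (card_sub_set L (fun l => x \in l)).
    exact: card_lines_through.
  by rewrite nbh_ln (card_imset _ pt_inj); apply/ordL/valP.
Qed.

End ProjectivePlane.

(** * Functionality of the incidence graph and its proper induced subgraphs *)

Theorem theorem1 (k : nat) (X : finType) (L : {set {set X}})
    (hk : 2 <= k) (hL : projective_plane L) (hord : has_order L k) :
  functionality (incidence_graph L) = k.+1 /\
  forall S : {set incidence_graph L}, S \proper [set: incidence_graph L] ->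
    functionality (induced S) <= k.
Proof.
have planeG := incidence_plane_graph hL hord.
set G := incidence_graph L in planeG *.
have degree (x : G) : #|nbh x| = k.+1 by case: planeG.
split.
  apply/eqP; rewrite eqn_leq; apply/andP; split.
    apply/bigmax_leqP => H /set0Pn[v vH].
    pose v' : induced H := exist _ v vH.
    apply: leq_trans (min_vfun_leq v') _.
    apply: leq_trans (vfun_leq_degree v') _.
    by rewrite -(degree v); apply: (@degree_embed (induced H) G val val_inj _ v').
  have [v _] : exists v : G, v \in [set: G].
    case: hL => _ _ [Y cardY _].
    have /card_gt0P[x _] : 0 < #|Y| by rewrite cardY.
    by exists (inl x); rewrite inE.
  have TG0 : [set: G] != set0 by apply/set0Pn; exists v.
  apply: leq_trans (leq_bigmax_cond [set: G] TG0).
  have val_bij : bijective (val : induced [set: G] -> G).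
    by exists (fun x => exist _ x (in_setT x)) => // x; apply: val_inj.
  have planeT := plane_graph_bij val_bij (fun _ _ => erefl) planeG.
  apply: (big_ind (fun m => k < m)) => [|m n hm hn|w _].
  (* The default value of the minimum, the number of vertices, exceeds some [vfun] and hence [k]. *)
  - apply: leq_trans (vfun_lt_card (exist _ v (in_setT v) : induced [set: G])).
    by rewrite ltnS ltnW //; apply: plane_graph_vfun_gt planeT _ hk.
  - by rewrite leq_min hm.
  - exact: plane_graph_vfun_gt planeT _ hk.
move=> S properS; apply/bigmax_leqP => H /set0Pn[v vH].
pose f (w : induced H) : G := val (val w).
have f_inj : injective f by apply: inj_comp; apply: val_inj.
(* Either an edge leaves the image of [H], and its end in [H] has degree at most [k] there, or the
   image is closed under adjacency. In that case connectedness makes it all of [G], although it lies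
   in the proper subset [S]. *)
have [/existsP[w /existsP[y /andP[wy yH]]]|closedH] :=
    boolP [exists w : induced H, exists y : G, adj (f w) y && (y \notin codom f)].
  apply: leq_trans (min_vfun_leq w) _; apply: leq_trans (vfun_leq_degree w) _.
  rewrite -ltnS -(degree (f w)); apply: degree_embed_lt wy _ => // z.
  by apply: contraNneq yH => <-; apply: codom_f.
have codomT : [set y in codom f] = setT.
  apply: (plane_graph_connected planeG (x := f (exist _ v vH))).
    by rewrite inE codom_f.
  move=> y z; rewrite !inE => /codomP[w ->] wz.
  by have /existsPn/(_ z) := existsPn closedH w; rewrite wz negbK.
case/properP: properS => _ [y _ /negP[]].
have : y \in [set y in codom f] by rewrite codomT.
by rewrite inE => /codomP[w ->]; apply: valP.
Qed.
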